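(* Let $(P,S)$ be an election with winner set $W(P,S)=\{C_1,\dots,C_S\}$ under the single transferable vote (STV) method. Suppose a collection of identical ballots is added to the ballots in $P$, creating a new preference profile $P'$, such that $C_1,\dots,C_S$ are (in some order) the candidates ranked in the top $S$ positions on the added ballots. Then $W(P,S)\cap W(P',S)\neq\emptyset$.
   Context: Ballots and profiles: there are $n$ candidates and $S\ge 1$ seats to fill. A ballot is a strict preference ranking of some (not necessarily all) of the candidates; partial rankings are allowed. A preference profile $P$ is a finite collection (multiset) of ballots, one per voter. An election is a pair $(P,S)$. Adding ballots to $P$ changes neither the set of candidates nor $S$; the quota is recomputed for the new number of voters. STV (standard Scottish rules): the method takes $(P,S)$ and outputs a set $W(P,S)$ of $S$ winners. The quota is $$q=\left\lfloor \frac{\text{number of voters}}{S+1}\right\rfloor+1$$ and is fixed throughout the count. Initially each ballot has weight $1$ and is held by its first-ranked candidate. In any round, a candidate's (first-place) vote total is the total weight of the ballots that candidate currently holds. The count proceeds in rounds: (i) Any candidate, not elected or eliminated, whose vote total is at least $q$ is elected. Surplus votes of elected candidates are transferred: if $X$ is elected with vote total $v\ge q$, then $X$ retains $q$ votes, and each ballot held by $X$ is passed on, with its weight multiplied by $(v-q)/v$, to the next candidate on that ballot who is neither elected nor eliminated (if there is none, that weight is no longer held by any candidate in the count). If several elected candidates have untransferred surpluses, these are transferred one at a time, the largest vote total first; candidates who have already reached quota receive no transfers. (ii) If no candidate newly achieves quota and no surplus remains to be transferred, the non-elected, non-eliminated candidate with the fewest votes is eliminated, and each ballot held by that candidate is passed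 on, at its current weight, to the next candidate on that ballot who is neither elected nor eliminated (if there is none, the ballot is exhausted). The process stops when $S$ candidates have been elected, or when some number $S'<S$ of candidates have been elected by reaching quota and only $S-S'$ candidates remain who are neither elected nor eliminated; in the latter case these remaining candidates are also elected. Ties: the issue of ties is avoided; that is, $(P,S)$ and $(P',S)$ are assumed to be elections whose winner set does not depend on how ties are broken, so that $W(P,S)$ and $W(P',S)$ are well defined. *)

(* Defs.v *)
From mathcomp Require Import all_boot all_order all_algebra.
From Stdlib Require Import Relation_Operators.

Set Implicit Arguments.
Unset Strict Implicit.
Unset Printing Implicit Defensive.

Import Order.TTheory GRing.Theory Num.Theory.

Local Open Scope ring_scope.

Definition ballot (C : finType) := {b : seq C | uniq b && (b != [::])}.

(* A multiset of ballots is listed in an arbitrary order: the rules below only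
   use the number of ballots and sums over them. *)
Definition profile (C : finType) := seq (ballot C).

Definition quota (V S : nat) : nat := (V %/ S.+1).+1.

(* A paper (r, w) is a ballot of current weight w held by the head of r, with
   the later preferences in the tail of r; it is exhausted when r = [::].
   [pending] is the part of [elected] whose surplus is not yet transferred.
   The q votes retained by a candidate after its transfer are not recorded,
   since no rule refers to them again. *)
Record state (C : finType) := State {
  elected : {set C};
  pending : {set C};
  eliminated : {set C};
  papers : seq (seq C * rat)
}.

Section Count.

Variable C : finType.
Implicit Types (P : profile C) (S : nat) (st : state C) (x y : C).

Definition init P : state C :=
  State set0 set0 set0 [seq (val b, 1) | b <- P].

Definition hopeful st : {set C} := ~: (elected st :|: eliminated st).

Definition holds x (p : seq C * rat) : bool := ohead p.1 == Some x.

Definition votes st x : rat := \sum_(p <- papers st | holds x p) p.2.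

Definition pass_on (H : {set C}) x (a : rat) (ps : seq (seq C * rat)) :=
  [seq if holds x p then
         let r := behead p.1 in (drop (find (fun y => y \in H) r) r, p.2 * a)
       else p | p <- ps].

Definition reaching_quota (q : nat) st : {set C} :=
  [set x in hopeful st | q%:R <= votes st x].

Definition stopped S st : bool :=
  (#|elected st| == S)
  || ((#|elected st| < S)%N && (#|hopeful st| == S - #|elected st|)%N).

Definition winners S st : {set C} :=
  if #|elected st| == S then elected st else elected st :|: hopeful st.

(* One move of the count; a tie for the largest surplus or for the fewest votes
   allows several moves. A candidate elected with exactly q votes also passes
   through [step_transfer], with factor 0. *)
Inductive step S (q : nat) st : state C -> Prop :=
| step_elect :
    ~~ stopped S st ->
    reaching_quota q st != set0 ->
    step S q st
      (State (elected st :|: reaching_quota q st)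
             (pending st :|: reaching_quota q st)
             (eliminated st)
             (papers st))
| step_transfer x :
    ~~ stopped S st ->
    reaching_quota q st = set0 ->
    x \in pending st ->
    (forall y, y \in pending st -> votes st y <= votes st x) ->
    step S q st
      (State (elected st)
             (pending st :\ x)
             (eliminated st)
             (pass_on (hopeful st) x ((votes st x - q%:R) / votes st x)
                      (papers st)))
| step_eliminate x :
    ~~ stopped S st ->
    reaching_quota q st = set0 ->
    pending st = set0 ->
    x \in hopeful st ->
    (forall y, y \in hopeful st -> votes st x <= votes st y) ->
    step S q st
      (State (elected st)
             (pending st)
             (x |: eliminated st)
             (pass_on (hopeful st :\ x) x 1 (papers st))).

Definition outcome P S (W : {set C}) : Prop :=
  exists st, [/\ clos_refl_trans _ (step S (quota (size P) S)) (init P) st,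
                 stopped S st & W = winners S st].

(* W(P, S) is well defined and equal to W: some way of breaking the ties
   produces W, and no way of breaking them produces another set. *)
Definition winner_set P S (W : {set C}) : Prop :=
  outcome P S W /\ (forall W0, outcome P S W0 -> W0 = W).

End Count.

(* Main.v *)
(* Follow the count of P until somebody first reaches quota. Before that only
   losers are eliminated, and the count of P' can make the same eliminations,
   with the added ballots resting on their first candidate; if P stops without
   any quota being reached, so does P' with the same winners, unless a member of
   W reaches the quota of P' on the way. Otherwise some winner c of P has reached
   the quota q > V/(S+1) with original votes. In the count of P', as long as no
   member of W is elected and c is not eliminated, the added k ballots sit on
   members of W ranked at or above c. If S candidates outside W were elected by
   quota, they and c would account for (S+1)q > V original votes. If c is
   eliminated, it does not hold the added ballots (q + k is at least the quota of
   P'); some other d in W holds them, and all elected or hopeful candidates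
   except d account for at least q original votes each, so there are at most S of
   them. Hence S candidates remain after the elimination of c, and d is seated. *)
Require Import Defs.
From mathcomp Require Import all_boot all_order all_algebra.
From mathcomp Require Import zify lra.
From Stdlib Require Import Relation_Operators Operators_Properties.

Set Implicit Arguments.
Unset Strict Implicit.
Unset Printing Implicit Defensive.

Import Order.TTheory GRing.Theory Num.Theory.

(** * Arithmetic of the quota *)

Lemma ltn_quota (V S : nat) : (V < quota V S * S.+1)%N.
Proof. exact: ltn_ceil. Qed.

Lemma leq_quota (V V' S : nat) : (V <= V')%N -> (quota V S <= quota V' S)%N.
Proof. by move=> leV; rewrite ltnS leq_div2r. Qed.

(** From [V < q * S.+1] follows [V + k < (q + k) * S.+1]. *)
Lemma quota_addr (V k S : nat) : (quota (V + k) S <= quota V S + k)%N.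
Proof.
rewrite -ltnS ltnS ltn_divLR // addSn.
by have := ltn_quota V S; rewrite /quota; nia.
Qed.

Section Tally.

Local Open Scope ring_scope.

Variable C : finType.
Implicit Types (x y : C) (H A : {set C}) (p : seq C * rat).
Implicit Types (ps : seq (seq C * rat)) (st : state C) (S q V : nat).

(** * Vote totals of lists of papers, and the effect of a transfer on them *)

(** Defined on a bare list, unlike [votes], so that original and added papers can be counted
    separately. *)
Definition tally ps x : rat := \sum_(p <- ps | holds x p) p.2.

Definition nonneg ps := all (fun p => 0 <= p.2) ps.

Lemma tally_cons p ps x :
  tally (p :: ps) x = (if holds x p then p.2 else 0) + tally ps x.
Proof. by rewrite /tally big_cons; case: ifP => //; rewrite add0r. Qed.

Lemma tally_cat ps1 ps2 x : tally (ps1 ++ ps2) x = tally ps1 x + tally ps2 x.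
Proof. exact: big_cat. Qed.

Lemma tally_ge0 ps x : nonneg ps -> 0 <= tally ps x.
Proof.
by move=> /allP ge0; rewrite /tally big_seq_cond sumr_ge0 // => p /andP[/ge0].
Qed.

Lemma tally_nseq k (r : seq C) x :
  tally (nseq k (r, 1)) x = if ohead r == Some x then k%:R else 0.
Proof.
elim: k => [|k IH]; first by rewrite /tally big_nil; case: ifP.
rewrite /= tally_cons IH /holds /=.
by case: ifP => _; rewrite ?addr0 // -natr1 addrC.
Qed.

Lemma pass_on_cat H x a ps1 ps2 :
  pass_on H x a (ps1 ++ ps2) = pass_on H x a ps1 ++ pass_on H x a ps2.
Proof. exact: map_cat. Qed.

Lemma nonneg_pass_on H x a ps :
  0 <= a -> nonneg ps -> nonneg (pass_on H x a ps).
Proof.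
move=> a0 /allP ge0; apply/allP => _ /mapP[p /ge0 p0 ->].
by case: ifP => // _; rewrite mulr_ge0.
Qed.

(** Only papers held by [x] move, so [y] loses nothing and may receive nonnegative weight. *)
Lemma tally_pass_on_ge H x a ps y :
  0 <= a -> nonneg ps -> y != x -> tally ps y <= tally (pass_on H x a ps) y.
Proof.
move=> a0 + yx; elim: ps => [|p ps IH] //= /andP[p0 /IH {}IH].
rewrite !tally_cons lerD //; case: ifP => [hy|_].
  have -> : holds x p = false.
    by apply: contraNF yx; move: hy; rewrite /holds => /eqP-> /eqP[->].
  by rewrite hy.
by case: (holds x p); case: ifP => //= _; rewrite mulr_ge0.
Qed.

Lemma sum_holds A p :
  \sum_(y in A) (if holds y p then p.2 else 0)
  = if ohead p.1 is Some y then (if y \in A then p.2 else 0) else 0.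
Proof.
rewrite /holds; case: (ohead p.1) => [z|]; last by rewrite big1.
rewrite -big_mkcondr /=; case: ifP => zA.
  by rewrite (big_pred1 z) // => y /=; apply/andP/eqP => [[_ /eqP[]]|->].
by rewrite big1 // => y /andP[yA /eqP[e]]; rewrite e yA in zA *.
Qed.

(** Paper by paper: one leaving [x] has at most one new holder. Equality can fail, because a paper
    may be exhausted or land outside [A]. *)
Lemma sum_tally_pass_on H A x a ps :
  x \notin H -> 0 <= a -> nonneg ps ->
  \sum_(y in A) tally (pass_on H x a ps) y
  <= \sum_(y in A :\ x) tally ps y + a * tally ps x.
Proof.
move=> xH a0; elim: ps => [|p ps IH] /=.
  by rewrite /tally !big_nil mulr0 addr0 !big1 // => y _; rewrite big_nil.
case/andP=> p0 /IH {}IH.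
under eq_bigr do rewrite tally_cons.
under [X in _ <= X + _]eq_bigr do rewrite tally_cons.
rewrite tally_cons !big_split /= !sum_holds mulrDr addrACA lerD //.
have [hx|hx] := boolP (holds x p); rewrite ?hx ?(negPf hx).
  have -> /= : ohead p.1 = Some x by apply/eqP.
  rewrite !inE eqxx /= add0r mulrC.
  case: (ohead _) => [y|]; last by rewrite mulr_ge0.
  by case: ifP => // _; rewrite mulr_ge0.
rewrite mulr0 addr0; move: hx; rewrite /holds.
case: (ohead p.1) => [y|] // yx; rewrite !inE.
by case: (eqVneq y x) yx => [->|]; rewrite ?eqxx.
Qed.

(** * The budget of original votes *)

(** The list [ps] is independent of [papers st], so the original papers can be followed in a state
    that also contains added ones. Candidates in [elected st :\: pending st] have been transferred,
    and each has used up [q] of the [V] votes. *)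
Definition accounts q V st ps :=
  [/\ nonneg ps, pending st \subset elected st,
      {in pending st, forall x, q%:R <= tally ps x}
    & q%:R * #|elected st :\: pending st|%:R
      + \sum_(x in hopeful st :|: pending st) tally ps x <= V%:R].

Lemma hopefulE st x :
  (x \in hopeful st) = (x \notin elected st) && (x \notin eliminated st).
Proof. by rewrite !inE negb_or. Qed.

(** Disjoint shares of the budget: transferred candidates have kept [q'] votes, pending ones still
    hold at least [q'], members of [B] at least [q]. *)
Lemma accounts_count q q' V st ps (B : {set C}) :
  accounts q' V st ps -> (q <= q')%N -> B \subset hopeful st ->
  {in B, forall x, q%:R <= tally ps x} ->
  (q * (#|elected st| + #|B|) <= V)%N.
Proof.
move=> [ge0 pe pq le] qq' BH Bq; rewrite -(ler_nat rat); apply: le_trans le.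
have qq : q%:R <= q'%:R :> rat by rewrite ler_nat.
have dis : [disjoint B & pending st].
  rewrite disjoint_subset; apply/subsetP => x /(subsetP BH); rewrite hopefulE.
  by case/andP=> xe _; rewrite inE; apply: contra xe => /(subsetP pe).
have -> : (#|elected st| + #|B|
           = #|elected st :\: pending st| + #|B :|: pending st|)%N.
  rewrite cardsU (disjoint_setI0 dis) cards0 subn0.
  rewrite -(cardsID (pending st) (elected st)).
  by rewrite (setIidPr pe); lia.
rewrite natrM natrD mulrDr lerD //; first by rewrite ler_wpM2r.
rewrite (big_setID (B :|: pending st)) /=.
rewrite (setIidPr (setSU _ BH)).
rewrite -[X in X <= _]addr0 lerD //; last first.
  by rewrite sumr_ge0 // => x _; rewrite tally_ge0.
rewrite mulr_natr -sumr_const ler_sum // => x; rewrite inE => /orP[/Bq //|/pq].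
exact: le_trans.
Qed.

Lemma accounts_elect q V st ps (R : {set C}) :
  R \subset hopeful st -> {in R, forall x, q%:R <= tally ps x} ->
  accounts q V st ps ->
  accounts q V (State (elected st :|: R) (pending st :|: R)
                      (eliminated st) (papers st)) ps.
Proof.
move=> RH Rq [ge0 pe pq le]; split=> //=; first exact: setSU.
  by move=> x; rewrite inE => /orP[/pq|/Rq].
have RH' x : x \in R -> (x \notin elected st) && (x \notin eliminated st).
  by move=> /(subsetP RH); rewrite hopefulE.
congr (_ * _%:R + _ <= _): le.
  apply: eq_card => x; rewrite !inE; case xR: (x \in R); last by rewrite !orbF.
  by case/andP: (RH' _ xR) => /negPf-> _; rewrite andbF orbT.
apply: eq_bigl => x; rewrite !inE /=; case xR: (x \in R); last by rewrite !orbF.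
by rewrite !orbT; case/andP: (RH' _ xR) => /negPf-> /negPf->.
Qed.

(** The transfer factor leaves exactly [tally ps x - q] to pass on, and the missing [q] pays for the
    one more transferred candidate. *)
Lemma accounts_transfer q V st ps ps' x :
  (0 < q)%N -> x \in pending st -> accounts q V st ps ->
  accounts q V (State (elected st) (pending st :\ x) (eliminated st) ps')
    (pass_on (hopeful st) x ((tally ps x - q%:R) / tally ps x) ps).
Proof.
move=> q0 xp [ge0 pe pq le].
have xe := subsetP pe _ xp; have qx := pq _ xp.
have v0 : 0 < tally ps x by apply: lt_le_trans qx; rewrite ltr0n.
have a0 : 0 <= (tally ps x - q%:R) / tally ps x.
  by rewrite divr_ge0 ?subr_ge0 // ltW.
have xH : x \notin hopeful st by rewrite hopefulE xe.
split=> /=.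
- exact: nonneg_pass_on.
- exact: subset_trans (subsetDl _ _) pe.
- move=> y; rewrite !inE => /andP[yx /pq qy].
  by apply: le_trans qy _; apply: tally_pass_on_ge.
have cE : #|elected st :\: (pending st :\ x)| = #|elected st :\: pending st|.+1.
  rewrite -(add1n #|_|) (cardsD1 x) !inE eqxx xe /=; congr addn.
  by apply: eq_card => y; rewrite !inE; case: eqP => //= ->; rewrite xp.
rewrite cE -natr1 mulrDr mulr1.
have sE : hopeful st :|: pending st :\ x = (hopeful st :|: pending st) :\ x.
  by apply/setP => y; rewrite !inE; case: eqP => // ->; rewrite xe.
have := sum_tally_pass_on (hopeful st :|: pending st :\ x) xH a0 ge0.
rewrite divfK ?gt_eqF // {2}sE setDDl setUid.
move: le; rewrite (big_setD1 x) /=; last by rewrite inE xp orbT.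
rewrite /hopeful /=; lra.
Qed.

Lemma accounts_eliminate q V st ps ps' x :
  pending st = set0 -> x \in hopeful st -> accounts q V st ps ->
  accounts q V (State (elected st) (pending st) (x |: eliminated st) ps')
    (pass_on (hopeful st :\ x) x 1 ps).
Proof.
move=> p0 xH [ge0 pe pq le]; split=> /=.
- exact: nonneg_pass_on.
- exact: pe.
- by move=> y; rewrite p0 inE.
rewrite p0 setU0 in le *.
have hE : hopeful (State (elected st) set0 (x |: eliminated st) ps')
          = hopeful st :\ x.
  by apply/setP => y; rewrite !inE /=; case: eqP => //=; rewrite ?orbT.
have xH' : x \notin hopeful st :\ x by rewrite !inE eqxx.
rewrite hE setU0.
have := sum_tally_pass_on (hopeful st :\ x) xH' ler01 ge0.
rewrite setDDl setUid mul1r; move: le; rewrite (big_setD1 x xH) /=; lra.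
Qed.

(** * Sets of candidates along a count *)

Lemma disjoint_hopeful st : [disjoint elected st & hopeful st].
Proof.
rewrite disjoint_subset; apply/subsetP => x xe.
by rewrite inE hopefulE xe.
Qed.

Lemma card_elected_hopeful st :
  (#|elected st| + #|hopeful st| = #|elected st :|: hopeful st|)%N.
Proof.
by rewrite cardsU (disjoint_setI0 (disjoint_hopeful st)) cards0 subn0.
Qed.

Lemma elected_sub_winners S st : elected st \subset winners S st.
Proof. by rewrite /winners; case: ifP => // _; apply: subsetUl. Qed.

Lemma hopeful_sub_winners S st :
  (#|elected st| < S)%N -> hopeful st \subset winners S st.
Proof. by move=> lt; rewrite /winners ltn_eqF // subsetUr. Qed.

Lemma card_winners S st : stopped S st -> #|winners S st| = S.
Proof.
rewrite /stopped /winners; case: eqP => //= ne /andP[lt /eqP h].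
by rewrite -card_elected_hopeful h subnKC // ltnW.
Qed.

Lemma winners_disjoint_eliminated S st :
  [disjoint elected st & eliminated st] ->
  [disjoint winners S st & eliminated st].
Proof.
move=> dis; rewrite /winners; case: ifP => // _.
rewrite -setI_eq0 setIUl setU_eq0 !setI_eq0 dis disjoint_subset.
by apply/subsetP => x; rewrite hopefulE inE => /andP[].
Qed.

Lemma not_stopped_lt S st : ~~ stopped S st ->
  (S <= #|elected st| + #|hopeful st|)%N ->
  (S < #|elected st| + #|hopeful st|)%N.
Proof. rewrite /stopped; lia. Qed.

Lemma step_elected S q st st' :
  step S q st st' -> elected st \subset elected st'.
Proof. by case=> *; rewrite ?subsetUl. Qed.

Lemma step_eliminated S q st st' :
  step S q st st' -> eliminated st \subset eliminated st'.
Proof. by case=> *; rewrite ?subsetUr. Qed.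

Lemma step_disjoint S q st st' : step S q st st' ->
  [disjoint elected st & eliminated st] ->
  [disjoint elected st' & eliminated st'].
Proof.
case=> //= [_ _ dis|x _ _ _ xH _ dis].
  rewrite -setI_eq0 setIUl setU_eq0 !setI_eq0 dis disjoint_subset.
  by apply/subsetP => x; rewrite !inE negb_or -andbA => /and3P[].
rewrite -setI_eq0 setIUr setU_eq0 !setI_eq0 dis andbT disjoint_sym disjoints1.
by move: xH; rewrite hopefulE => /andP[].
Qed.

Lemma steps_elected S q st st' :
  clos_refl_trans_1n _ (step S q) st st' -> elected st \subset elected st'.
Proof. by elim=> // s1 s2 s3 /step_elected/subset_trans H _; apply: H. Qed.

Lemma steps_eliminated S q st st' :
  clos_refl_trans_1n _ (step S q) st st' ->
  eliminated st \subset eliminated st'.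
Proof. by elim=> // s1 s2 s3 /step_eliminated/subset_trans H _; apply: H. Qed.

Lemma steps_disjoint S q st st' :
  clos_refl_trans_1n _ (step S q) st st' ->
  [disjoint elected st & eliminated st] ->
  [disjoint elected st' & eliminated st'].
Proof. by elim=> // s1 s2 s3 /step_disjoint H _ IH /H. Qed.

Lemma steps_stopped S q st st' : stopped S st ->
  clos_refl_trans_1n _ (step S q) st st' -> st' = st.
Proof.
move=> sto st_st'; case: st_st' sto => // ? ? [].
- by move=> /negPf->.
- by move=> ? /negPf->.
- by move=> ? /negPf->.
Qed.

(** * Progress and termination of the count *)

Definition sound q V S st :=
  accounts q V st (papers st) /\ (S <= #|elected st| + #|hopeful st|)%N.

Lemma reaching_quota_sub q st : reaching_quota q st \subset hopeful st.
Proof. by apply/subsetP => x; rewrite inE => /andP[]. Qed.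

Lemma hopeful_elect R st ps :
  hopeful (State (elected st :|: R) (pending st :|: R) (eliminated st) ps)
  = hopeful st :\: R.
Proof.
by apply/setP => x; rewrite !inE; case: (x \in R); rewrite ?orbT ?orbF.
Qed.

Lemma hopeful_eliminate x st ps :
  hopeful (State (elected st) (pending st) (x |: eliminated st) ps)
  = hopeful st :\ x.
Proof. by apply/setP => y; rewrite !inE; case: (y == x); rewrite ?orbT. Qed.

Lemma step_card S q st st' : step S q st st' ->
  (S <= #|elected st| + #|hopeful st|)%N ->
  (S <= #|elected st'| + #|hopeful st'|)%N.
Proof.
case=> [_ _|x _ _ _ _|x ns _ _ xH _ le] //.
  rewrite !card_elected_hopeful hopeful_elect /= => le.
  apply: leq_trans le (subset_leq_card _); apply/subsetP => x.
  rewrite !inE; case: (x \in elected st); case: (_ && (_ <= _));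
  by rewrite ?orbT ?orbF /= ?andbT.
rewrite hopeful_eliminate; have := not_stopped_lt ns le.
by rewrite (cardsD1 x (hopeful st)) xH /=; lia.
Qed.

Lemma step_sound S q V st st' :
  (0 < q)%N -> step S q st st' -> sound q V S st -> sound q V S st'.
Proof.
move=> q0 st_st' [acc le]; split; last exact: step_card st_st' le.
case: st_st' => [_ _|x _ _ xp _|x _ _ p0 xH _].
- apply: accounts_elect => //; first exact: reaching_quota_sub.
  by move=> x; rewrite inE => /andP[].
- exact: accounts_transfer.
- exact: accounts_eliminate.
Qed.

(** A hopeful candidate weighs 2 and a pending one 1, so that becoming elected also decreases the
    measure. *)
Lemma step_measure S q st st' : step S q st st' ->
  (#|hopeful st'|.*2 + #|pending st'| < #|hopeful st|.*2 + #|pending st|)%N.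
Proof.
case=> [_ R0|x _ _ xp _|x _ _ p0 xH _].
- rewrite hopeful_elect /= cardsD (setIidPr (reaching_quota_sub _ _)).
  have := subset_leq_card (reaching_quota_sub q st).
  have := (leq_card_setU (pending st) (reaching_quota q st)).1.
  by move: R0; rewrite -card_gt0; lia.
- by rewrite ltn_add2l [X in (_ < X)%N](cardsD1 x) xp.
- by rewrite hopeful_eliminate ltn_add2r (cardsD1 x (hopeful st)) xH; lia.
Qed.

Lemma step_exists S q V st :
  (V < q * S.+1)%N -> sound q V S st -> ~~ stopped S st ->
  exists st', step S q st st'.
Proof.
move=> Vq [acc le] ns.
have [R0|R0] := eqVneq (reaching_quota q st) set0; last first.
  by eexists; apply: step_elect.
have [p0|/set0Pn[x0 x0p]] := eqVneq (pending st) set0; last first.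
  case: (@arg_maxP _ _ _ x0 (mem (pending st)) (votes st) x0p) => x xp xmax.
  by eexists; apply: (step_transfer (x := x)).
(* Overshooting [S] would leave the count unstopped, possibly with nobody to eliminate; the quota
   rules this out. *)
have eS : (#|elected st| <= S)%N.
  have B0 : {in set0, forall x, q%:R <= tally (papers st) x}.
    by move=> x; rewrite inE.
  have := accounts_count acc (leqnn q) (sub0set _) B0.
  by rewrite cards0; nia.
have : (0 < #|hopeful st|)%N.
  by have := not_stopped_lt ns le; move: ns; rewrite /stopped; lia.
case/card_gt0P => x0 x0H.
case: (@arg_minP _ _ _ x0 (mem (hopeful st)) (votes st) x0H) => x xH xmin.
by eexists; apply: (step_eliminate (x := x)).
Qed.

Lemma count_terminates S q V st :
  (V < q * S.+1)%N -> sound q V S st ->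
  exists fin, clos_refl_trans_1n _ (step S q) st fin /\ stopped S fin.
Proof.
move=> Vq; have q0 : (0 < q)%N by case: q Vq.
have [n] := ubnP (#|hopeful st|.*2 + #|pending st|)%N.
elim: n st => // n IH st lt snd.
have [sto|ns] := boolP (stopped S st).
  by exists st; split=> //; constructor.
have [st' st_st'] := step_exists Vq snd ns.
have [||fin [st'_fin sto]] := IH st'.
- by have := step_measure st_st'; lia.
- exact: step_sound st_st' snd.
by exists fin; split=> //; econstructor; eauto.
Qed.

(** * The count with added ballots once a winner has an original quota *)

(** The search for the next holder cannot skip [c], so a moved ballot keeps the shape of a prefix
    followed by [c :: r2]. *)
Lemma drop_find_cat H (r1 r2 : seq C) c : c \in H ->
  exists r, [/\ drop (find (fun y => y \in H) (r1 ++ c :: r2)) (r1 ++ c :: r2)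
                = r ++ c :: r2, {subset r <= r1} & head c r \in H].
Proof.
move=> cH; elim: r1 => [|y r1 [r [e sub hH]]] /=.
  by rewrite cH; exists [::].
have [yH|yH] := boolP (y \in H); first by exists (y :: r1); split.
by exists r; split=> // z /sub zr; rewrite inE zr orbT.
Qed.

Lemma ohead_cat_cons (r1 r2 : seq C) c :
  ohead (r1 ++ c :: r2) = Some (head c r1).
Proof. by case: r1. Qed.

(* [c] has a full original quota and the added papers are still held inside [W],
   having at worst to move down to [c]. *)
Definition pivotal q q' V k (W : {set C}) c st := exists os r1 r2,
  [/\ papers st = os ++ nseq k (r1 ++ c :: r2, 1), accounts q' V st os,
      c \in hopeful st, q%:R <= tally os c
    & {subset r1 <= W} /\ head c r1 \in hopeful st].

Lemma pivotal_step S q q' V k (W : {set C}) c st st' :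
  (q <= q')%N -> (q' <= q + k)%N -> (V < q * S.+1)%N -> c \in W ->
  (S <= #|elected st| + #|hopeful st|)%N -> [disjoint W & elected st] ->
  pivotal q q' V k W c st -> step S q' st st' ->
  pivotal q q' V k W c st' \/
  forall fin, clos_refl_trans_1n _ (step S q') st' fin ->
    stopped S fin -> ~~ [disjoint W & winners S fin].
Proof.
move=> qq' q'q Vq cW le dis [os [r1 [r2 [e acc cH cq [r1W dH]]]]] st_st'.
have [ge0 pe pq _] := acc.
set d := head c r1 in dH.
have dW : d \in W.
  by rewrite /d; case: (r1) r1W => //= y r H; rewrite H ?inE ?eqxx.
have votesE y : votes st y = tally os y + (if d == y then k%:R else 0).
  by rewrite /votes e [LHS]tally_cat tally_nseq ohead_cat_cons.
have q'0 : (0 < q')%N by apply: leq_trans qq'; case: (q) Vq.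
have pass_added H x a : d != x ->
    pass_on H x a (nseq k (r1 ++ c :: r2, 1)) = nseq k (r1 ++ c :: r2, 1).
  by move=> dx; rewrite /pass_on map_nseq /holds ohead_cat_cons ifN.
case: st_st' => [_ _|x _ _ xp _|x ns R0 p0 xH xmin].
- have [disR|] := boolP [disjoint W & reaching_quota q' st]; last first.
    move=> nd; right=> fin /steps_elected/= sub _; apply: contra nd.
    apply: disjointWr; apply: subset_trans (elected_sub_winners S fin).
    exact: subset_trans (subsetUr _ _) sub.
  have notR y : y \in W -> y \notin reaching_quota q' st.
    move=> yW; apply/negP => yR; move/pred0P: disR => /(_ y).
    by rewrite /= yW yR.
  left; exists os, r1, r2; split=> //.
  + apply: accounts_elect => //; first exact: reaching_quota_sub.
    (* The added papers sit on [d] in [W], so a candidate outside [W] reaches [q'] with original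
       votes alone. *)
    move=> y yR; have /negP yW : y \notin W by apply/negP => /notR; rewrite yR.
    move: yR; rewrite inE votesE => /andP[_].
    by case: eqP => [dy|_]; rewrite ?addr0 //; case: yW; rewrite -dy.
  + by rewrite hopeful_elect inE cH andbT notR.
  + by split=> //; rewrite hopeful_elect inE dH andbT notR.
(* A pending [x] is elected, hence outside [W]; it holds no added paper, and its transfer factor
   depends on original votes only. *)
- have xW : x \notin W.
    apply/negP => xW; move/pred0P: dis => /(_ x).
    by rewrite /= xW (subsetP pe).
  have dx : d != x by apply: contraNneq xW => <-.
  have cx : c != x by apply: contraNneq xW => <-.
  have vx : votes st x = tally os x by rewrite votesE (negPf dx) addr0.
  left; rewrite vx e pass_on_cat pass_added //.
  eexists _, r1, r2; split=> //; first exact: accounts_transfer.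
  apply: le_trans cq _; apply: tally_pass_on_ge => //.
  by rewrite divr_ge0 ?tally_ge0 // subr_ge0 pq.
have notq y : y \in hopeful st -> votes st y < q'%:R.
  move=> yH; rewrite ltNge; apply/negP => yq.
  by have : y \in reaching_quota q' st; [rewrite inE yH | rewrite R0 inE].
have [xc|xc] := eqVneq x c; last first.
  left; rewrite e pass_on_cat; exists (pass_on (hopeful st :\ x) x 1 os).
  have acc' ps := accounts_eliminate ps p0 xH acc.
  have cq' : q%:R <= tally (pass_on (hopeful st :\ x) x 1 os) c.
    by apply: le_trans cq _; apply: tally_pass_on_ge => //; rewrite eq_sym.
  have cH' : c \in hopeful st :\ x by rewrite in_setD1 eq_sym xc.
  have [dx|dx] := eqVneq d x; last first.
    exists r1, r2; rewrite pass_added ?hopeful_eliminate //.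
    by split=> //; split=> //; rewrite in_setD1 dx.
  have [r r1E] : exists r, r1 = x :: r.
    move: dx xc; rewrite /d; case: (r1) => [|y r] /= ->; first by rewrite eqxx.
    by exists r.
  have [r' [rE sub hH]] := drop_find_cat r r2 cH'.
  exists r', r2; rewrite hopeful_eliminate; split=> //.
    by rewrite r1E /pass_on map_nseq /holds /= eqxx rE mulr1.
  by split=> // z /sub zr; apply: r1W; rewrite r1E inE zr orbT.
right; subst x.
(* If [c] held the added papers it would have at least [q + k >= q'] votes, yet nobody reaches the
   quota here. *)
have dc : d != c.
  apply/eqP => dc; have := notq c cH; rewrite votesE dc eqxx ltNge => /negP[].
  by apply: le_trans (lerD cq (lexx _)); rewrite -natrD ler_nat.
have dH' : d \in hopeful st :\ c by rewrite in_setD1 dc.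
(* As [c] has the fewest votes, every hopeful candidate other than [d] has at least as many original
   votes as [c], hence at least [q]. *)
have cnt : (q * (#|elected st| + #|hopeful st :\ d|) <= V)%N.
  apply: accounts_count acc qq' (subsetDl _ _) _ => y.
  rewrite in_setD1 => /andP[yd yH]; apply: le_trans cq _.
  have := xmin y yH.
  by rewrite !votesE (negPf dc) [d == y]eq_sym (negPf yd) !addr0.
have hd : #|hopeful st :\ d| = #|hopeful st :\ c|.
  by have := cardsD1 d (hopeful st); rewrite (cardsD1 c) cH dH => -[].
have lt := not_stopped_lt ns le.
have hc := cardsD1 c (hopeful st); rewrite cH in hc.
have d0 : (0 < #|hopeful st :\ c|)%N by apply/card_gt0P; exists d.
set st2 := State _ _ _ _.
have hE : hopeful st2 = hopeful st :\ c by rewrite /st2 hopeful_eliminate.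
have eh : (#|elected st| + #|hopeful st :\ c| <= S)%N by rewrite -hd; nia.
have lt' : (#|elected st2| < S)%N by rewrite /=; lia.
(* Exactly [S] elected or hopeful candidates are left, so the count stops with [d] seated. *)
have sto : stopped S st2 by rewrite /stopped lt' hE /=; apply/orP; right; lia.
move=> fin /(steps_stopped sto)-> _; apply/negP => /pred0P/(_ d)/=.
by rewrite dW (subsetP (hopeful_sub_winners lt')) // hE.
Qed.

Lemma pivotal_wins S q q' V k (W : {set C}) c st fin :
  (q <= q')%N -> (q' <= q + k)%N -> (V < q * S.+1)%N -> c \in W ->
  (S <= #|elected st| + #|hopeful st|)%N -> pivotal q q' V k W c st ->
  clos_refl_trans_1n _ (step S q') st fin -> stopped S fin ->
  ~~ [disjoint W & winners S fin].
Proof.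
move=> qq' q'q Vq cW le piv st_fin.
elim: st_fin le piv => [{fin}st|{fin}st st' fin st_st' st'_fin IH] le piv sto.
  case: piv => os [r1 [r2 [_ acc cH cq _]]].
  (* With [S] elected, they and [c] would account for [q * S.+1 > V] original votes. With fewer, the
     stop seats the hopeful [c]. *)
  suff lt : (#|elected st| < S)%N.
    apply/negP => /pred0P/(_ c)/=; rewrite cW /=.
    by rewrite (subsetP (hopeful_sub_winners lt)).
  have cq' : {in [set c], forall x, q%:R <= tally os x} by move=> x /set1P->.
  have := accounts_count acc qq' _ cq'; rewrite sub1set cards1 => /(_ cH).
  by nia.
have [dis|nd] := boolP [disjoint W & elected st]; last first.
  apply: contra nd; apply: disjointWr.
  apply: subset_trans (elected_sub_winners S fin).
  exact: subset_trans (step_elected st_st') (steps_elected st'_fin).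
have [piv'|] := pivotal_step qq' q'q Vq cW le dis piv st_st'; last exact.
exact: IH (step_card st_st' le) piv' sto.
Qed.

(** * Running both counts in parallel until the first election *)

(** Induction on the count of [P], with nobody elected in either count so far. Finding one suitable
    count of [P'] suffices, since its winner set does not depend on ties. *)
Lemma mirror_count S q q' V k (b : seq C) ps E fin :
  let W := [set x in take S b] in
  let st' := State set0 set0 E (ps ++ nseq k (b, 1)) in
  (0 < S)%N -> (q <= q')%N -> (q' <= q + k)%N -> (V < q * S.+1)%N ->
  (V + k < q' * S.+1)%N -> accounts q' V st' ps -> sound q' (V + k) S st' ->
  clos_refl_trans_1n _ (step S q) (State set0 set0 E ps) fin ->
  stopped S fin -> winners S fin = W ->
  exists fin', [/\ clos_refl_trans_1n _ (step S q') st' fin', stopped S fin'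
                 & ~~ [disjoint W & winners S fin']].
Proof.
move=> W /= S0 qq' q'q Vq Vq' acc snd.
have q'0 : (0 < q')%N by case: (q') Vq'.
move stE: (State set0 set0 E ps) => st0 st0_fin.
elim: st0_fin E ps acc snd stE
  => [{fin}st|{fin}st st1 fin st_st1 st1_fin IH] E ps acc snd stE sto winE.
  subst st; exists (State set0 set0 E (ps ++ nseq k (b, 1))).
  split=> //; first by constructor.
  rewrite -[winners _ _]/(winners S (State set0 set0 E ps)) winE.
  rewrite -setI_eq0 setIid.
  by rewrite -card_gt0 -winE card_winners.
have W_b c : c \in W -> exists r1 r2, b = r1 ++ c :: r2 /\ {subset r1 <= W}.
  rewrite inE => cb; rewrite -{1}(cat_take_drop S b).
  have sub : {subset take S b <= W} by move=> x; rewrite inE.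
  case/splitPr: cb sub => r1 r2 sub; exists r1, (r2 ++ drop S b).
  by rewrite -catA; split=> // x xr; apply: sub; rewrite mem_cat xr.
have headW y : ohead b = Some y -> y \in W.
  rewrite inE; case: (b) S0 => // z r.
  by case: (S) => // n _ [->]; rewrite inE eqxx.
set st' := State set0 set0 E (ps ++ nseq k (b, 1)) in acc snd *.
have votes_ge y : votes st y <= votes st' y.
  by rewrite -stE [X in _ <= X]tally_cat tally_nseq lerDl; case: ifP.
have votes_out y : y \notin W -> votes st' y = votes st y.
  move=> yW; rewrite -stE [LHS]tally_cat tally_nseq ifN ?addr0 //.
  by apply: contra yW => /eqP/headW.
have nsE : stopped S st' = stopped S st by rewrite -stE.
have hE : hopeful st' = hopeful st by rewrite -stE.
have st_fin : clos_refl_trans_1n _ (step S q) st fin by econstructor; eauto.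
(* Hence the first candidate of [b] is never eliminated in the count of [P], and the added papers
   stay put during the mirrored phase. *)
have notW x : x \in eliminated fin -> x \notin W.
  move=> xE; apply/negP; rewrite -winE => xw.
  suff /pred0P/(_ x) : [disjoint winners S fin & eliminated fin].
    by rewrite /= xw xE.
  apply/winners_disjoint_eliminated/(steps_disjoint st_fin).
  by rewrite -stE /= -setI_eq0 set0I.
case: st_st1 st1_fin IH => [ns R0|x _ _ xp _|x ns R0 p0 xH xmin] st1_fin IH.
(* First election in the count of [P]: any candidate [c] reaching [q] is in [W] and becomes the
   pivot, and any completion of the count of [P'] will do. *)
- have /set0Pn[c cR] := R0.
  have cW : c \in W.
    rewrite -winE (subsetP (elected_sub_winners S fin)) //.
    by rewrite (subsetP (steps_elected st1_fin)) //= inE cR orbT.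
  have [fin' [st'_fin' sto']] := count_terminates Vq' snd.
  exists fin'; split=> //.
  have [r1 [r2 [bE r1W]]] := W_b c cW.
  move: cR; rewrite inE -hE => /andP[cH cq].
  apply: (pivotal_wins qq' q'q Vq cW) st'_fin' sto'; first by case: snd.
  exists ps, r1, r2; split=> //; first by rewrite -bE.
    by rewrite -stE in cq.
  split=> //; rewrite hopefulE inE /=; apply: contraTN (headW (head c r1) _).
    move=> xE; apply: notW; apply: (subsetP (steps_eliminated st_fin)).
    by rewrite -stE.
  by rewrite bE ohead_cat_cons.
- by rewrite -stE inE in xp.
have xW : x \notin W.
  by apply: notW; rewrite (subsetP (steps_eliminated st1_fin)) //= !inE eqxx.
(* Thanks to the added papers, [q'] may be reached while nobody has [q] in the count of [P]; only a
   member of [W] can do so. *)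
have [R0'|R0'] := eqVneq (reaching_quota q' st') set0; last first.
  have ns' : ~~ stopped S st' by rewrite nsE.
  have st'_st2 := step_elect ns' R0'.
  have [fin' [st2_fin' sto']] :=
    count_terminates Vq' (step_sound q'0 st'_st2 snd).
  exists fin'; split=> //; first by econstructor; eauto.
  case/set0Pn: R0' => y yR.
  have yW : y \in W.
    apply: contraTT yR => yW; rewrite inE hE votes_out // negb_and -implybE.
    apply/implyP => yH; rewrite -ltNge.
    apply: lt_le_trans (_ : q%:R <= _); last by rewrite ler_nat.
    rewrite ltNge; apply/negP => yq.
    by have : y \in reaching_quota q st; [rewrite inE yH | rewrite R0 inE].
  apply/negP => /pred0P/(_ y)/=.
  rewrite yW (subsetP (elected_sub_winners S fin')) //.
  by rewrite (subsetP (steps_elected st2_fin')) // in_setU yR orbT.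
have st'_st2 : step S q' st' (State set0 set0 (x |: E)
    (pass_on (hopeful st :\ x) x 1 ps ++ nseq k (b, 1))).
  have -> : pass_on (hopeful st :\ x) x 1 ps ++ nseq k (b, 1)
    = pass_on (hopeful st' :\ x) x 1 (papers st').
    rewrite hE pass_on_cat; congr (_ ++ _).
    rewrite /pass_on map_nseq /holds /= ifN //.
    by apply: contra xW => /eqP/headW.
  apply: step_eliminate => //; rewrite ?nsE ?hE //.
  (* The loser [x] is outside [W] and gains nothing from the added papers, while the other totals
     can only grow, so [x] is still last. *)
  move=> y yH; rewrite votes_out //; apply: le_trans (votes_ge y).
  exact: xmin.
have [|||||fin' [st2_fin' sto' meet]] :=
  IH (x |: E) (pass_on (hopeful st :\ x) x 1 ps) => //.
- by rewrite -hE; apply: (@accounts_eliminate q' V st'); rewrite ?hE.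
- exact: step_sound q'0 st'_st2 snd.
- by rewrite -stE.
by exists fin'; split=> //; econstructor; eauto.
Qed.

(** * The initial state and the conclusion *)

(** Nobody is elected yet, so any [q] is allowed, and each ballot has weight 1 and at most one
    holder. *)
Lemma sound_init (P : profile C) S q : (S <= #|C|)%N ->
  sound q (size P) S (init P).
Proof.
move=> SC; split; last first.
  rewrite card_elected_hopeful; apply: leq_trans SC _; rewrite -cardsT.
  by apply/subset_leq_card/subsetP => x; rewrite !inE.
split=> /=; first by apply/allP => _ /mapP[b _ ->].
- exact: sub0set.
- by move=> x; rewrite inE.
rewrite setD0 cards0 mulr0 add0r.
elim: P => [|b P IH] /=.
  by rewrite big1 // => y _; rewrite /tally big_nil.
under eq_bigr do rewrite tally_cons.
rewrite big_split sum_holds /= -natr1 addrC lerD //.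
by case: (ohead _) => // y; case: ifP.
Qed.

End Tally.

Theorem proposition1 (C : finType) (S k : nat) (P : profile C) (b : ballot C)
    (W W' : {set C}) (hS : 0 < S)
    (hW : winner_set P S W)
    (hb : [set x in take S (val b)] = W)
    (hW' : winner_set (P ++ nseq k b) S W') :
  W :&: W' != set0.
Proof.
case: hW => -[fin [/clos_rt_rt1n_iff st_fin sto winE]] _.
case: hW' => _ W'_unique.
have SC : (S <= #|C|)%N by rewrite -(card_winners sto) max_card.
have sizeE : size (P ++ nseq k b) = size P + k by rewrite size_cat size_nseq.
have initE : init (P ++ nseq k b)
    = State set0 set0 set0
        ([seq (val b, 1%R) | b <- P] ++ nseq k (val b, 1%R)).
  by rewrite /init map_cat map_nseq.
(* The original ballots are budgeted at the quota of the enlarged profile, since they are followed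
   in its count. *)
have [acc _] := @sound_init C P S (quota (size P + k) S) SC.
have snd := @sound_init C (P ++ nseq k b) S (quota (size P + k) S) SC.
rewrite sizeE initE in snd.
have [|fin' [st'_fin' sto' meet]] := mirror_count hS
    (leq_quota S (leq_addr k (size P))) (quota_addr (size P) k S)
    (ltn_quota (size P) S) (ltn_quota (size P + k) S) acc snd st_fin sto.
  by rewrite -winE hb.
rewrite setI_eq0 -(W'_unique (winners S fin')) -?hb //.
by exists fin'; split=> //; apply/clos_rt_rt1n_iff; rewrite sizeE initE.
Qed.
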